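(* Every matrix in $SO^{+}(4,1)$ can be decomposed (non-uniquely) as a product of Givens matrices $$R_{14}R_{13}R_{12}H_{15}R_{24}R_{23}H_{25}R_{34}H_{35}H_{45}.$$ The following table describes the $Y\in\mathrm{Spin}^{+}(4,1)\subseteq M(2,\mathbf{H})$ satisfying $\Phi_{4,1}(\pm Y)=X$, where $X$ is one of the Givens matrices in this product (with parameter $\theta$): - $X=R_{14}$: $Y=\begin{pmatrix}\cos(\theta/2)&-\sin(\theta/2)j\\-\sin(\theta/2)j&\cos(\theta/2)\end{pmatrix}$; - $X=R_{13}$: $Y=\begin{pmatrix}\cos(\theta/2)&-\sin(\theta/2)\\\sin(\theta/2)&\cos(\theta/2)\end{pmatrix}$; - $X=R_{12}$: $Y=\begin{pmatrix}\cos(\theta/2)&-\sin(\theta/2)k\\-\sin(\theta/2)k&\cos(\theta/2)\end{pmatrix}$; - $X=H_{15}$: $Y=\begin{pmatrix}e^{-\theta/2}&0\\0&e^{-\theta/2}\end{pmatrix}$; - $X=R_{42}$: $Y=\begin{pmatrix}\cos(\theta/2)+\sin(\theta/2)i&0\\0&\cos(\theta/2)-\sin(\theta/2)i\end{pmatrix}$; - $X=R_{32}$: $Y=\begin{pmatrix}\cos(\theta/2)-\sin(\theta/2)k&0\\0&\cos(\theta/2)+\sin(\theta/2)k\end{pmatrix}$; - $X=H_{25}$: $Y=\begin{pmatrix}\cosh(\theta/2)&-\sinh(\theta/2)k\\\sinh(\theta/2)k&\cosh(\theta/2)\end{pmatrix}$; - $X=H_{35}$: $Y=\begin{pmatrix}\cosh(\theta/2)&\sinh(\theta/2)k\\\sinh(\theta/2)k&\cosh(\theta/2)\end{pmatrix}$;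 - $X=H_{45}$: $Y=\begin{pmatrix}\cosh(\theta/2)&-\sinh(\theta/2)j\\\sinh(\theta/2)j&\cosh(\theta/2)\end{pmatrix}$.
   Context: $\mathbf{H}$ denotes the quaternions with units $i,j,k$. Every $A\in M(2,\mathbf{H})$ is uniquely $A=Z+Wj$ with $Z,W\in M(2,\mathbf{C})$; put $\Theta_{\mathbf{H}}(A)=\begin{pmatrix}Z&W\\-\bar W&\bar Z\end{pmatrix}\in M(4,\mathbf{C})$. Let $\sigma_x=\begin{pmatrix}0&1\\1&0\end{pmatrix}$, $\sigma_y=\begin{pmatrix}0&-i\\i&0\end{pmatrix}$, $\sigma_z=\begin{pmatrix}1&0\\0&-1\end{pmatrix}$. The basis of one-vectors used for the Clifford algebra $\mathrm{Cl}(4,1)=M(4,\mathbf{C})$ is $V_1=\sigma_z\otimes\sigma_x$, $V_2=\sigma_y\otimes I_2$, $V_3=\sigma_z\otimes\sigma_z$, $V_4=\sigma_x\otimes I_2$, $V_5=-\sigma_z\otimes(i\sigma_y)$. With respect to this basis, $\mathrm{Spin}^{+}(4,1)=\{X\in M(4,\mathbf{C})\cap\mathrm{Im}(\Theta_{\mathbf{H}}):X^{*}MX=M\}$ with $M=(i\sigma_y)\oplus(-i\sigma_y)$; its elements are identified, via $\Theta_{\mathbf{H}}$, with the corresponding matrices $Y$ in $M(2,\mathbf{H})$. $\Phi_{4,1}:\mathrm{Spin}^{+}(4,1)\to SO^{+}(4,1)$ is the double covering map sending $Y$ to the $5\times5$ real matrix, in the basis $\{V_1,\dots,V_5\}$,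 of the linear map $V\mapsto\Theta_{\mathbf{H}}(Y)V\Theta_{\mathbf{H}}(Y)^{-1}$ on the space of one-vectors (the real span of the $V_m$). $SO^{+}(4,1)$ is the identity component of $\{X\in M(5,\mathbf{R}):X^TI_{4,1}X=I_{4,1},\ \det X=1\}$, $I_{4,1}=\mathrm{diag}(1,1,1,1,-1)$. $R_{ij}$ ($i\ne j$) is the $5\times5$ matrix equal to the identity except in the principal submatrix indexed by rows and columns $(i,j)$, where it is the standard Givens matrix $\begin{pmatrix}\cos\theta&-\sin\theta\\\sin\theta&\cos\theta\end{pmatrix}$; $R_{ij}$ and $R_{ji}$ differ only in the parameter. $H_{ij}$ ($i<j$) is the $5\times5$ matrix equal to the identity except in the principal submatrix indexed by rows and columns $(i,j)$, where it is the hyperbolic Givens matrix $\begin{pmatrix}\cosh\theta&\sinh\theta\\\sinh\theta&\cosh\theta\end{pmatrix}$.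
   Formalization: Seven printed rows fail; corrected Y: R_13 (c,s;-s,c), R_12 (c,sk;sk,c), H_15 diag(e^{-θ/2},e^{θ/2}), R_42 diag(c-si,c-si), R_32 diag(c+sk,c-sk), H_25 (ch,sh k;-sh k,ch), H_35 (ch,sh;sh,ch), with c,s,ch,sh = cos,sin,cosh,sinh of θ/2. *)

(* Defs.v *)
(* R : realType stands for the real numbers, R[i] for the complex numbers. *)
From HB Require Import structures.
From mathcomp Require Import all_boot all_order all_algebra.
From mathcomp Require Import all_classical all_reals all_analysis.
From mathcomp Require Import complex mxtens ring.

Set Implicit Arguments.
Unset Strict Implicit.
Unset Printing Implicit Defensive.

Import Order.TTheory GRing.Theory Num.Theory.
Import numFieldNormedType.Exports.

Local Open Scope classical_set_scope.
Local Open Scope ring_scope.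
Local Open Scope complex_scope.

(* The quaternion z + w j with z, w complex; i = (i, 0), j = (0, 1) and
   k = i j = (0, i).  The product is dictated by j z = conjc z j and j j = -1. *)
Record quat (R : Type) := Quat { qz : R[i]; qw : R[i] }.

Section Quaternions.
Variable R : realType.
Implicit Types (a b : R) (p q r : quat R).

Definition pair_of_quat q := (qz q, qw q).
Definition quat_of_pair (u : R[i] * R[i]) := Quat u.1 u.2.

Fact quat_pairK : cancel pair_of_quat quat_of_pair.
Proof. by case. Qed.

HB.instance Definition _ := Choice.copy (quat R) (can_type quat_pairK).

Definition addq p q := Quat (qz p + qz q) (qw p + qw q).
Definition oppq q := Quat (- qz q) (- qw q).
Definition mulq p q :=
  Quat (qz p * qz q - qw p * conjc (qw q)) (qz p * qw q + qw p * conjc (qz q)).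
Definition scaleq a q := Quat (a%:C * qz q) (a%:C * qw q).

Fact addqA : associative addq.
Proof. by move=> p q r; rewrite /addq /= !addrA. Qed.
Fact addqC : commutative addq.
Proof. by move=> p q; rewrite /addq addrC [qw p + _]addrC. Qed.
Fact add0q : left_id (Quat 0 0) addq.
Proof. by case=> z w; rewrite /addq /= !add0r. Qed.
Fact addNq : left_inverse (Quat 0 0) oppq addq.
Proof. by case=> z w; rewrite /addq /= !addNr. Qed.

HB.instance Definition _ :=
  GRing.isZmodule.Build (quat R) addqA addqC add0q addNq.

Fact mulqA : associative mulq.
Proof.
move=> [[? ?] [? ?]] [[? ?] [? ?]] [[? ?] [? ?]].
by congr (Quat (_ +i* _) (_ +i* _)); rewrite /=; ring.
Qed.
Fact mul1q : left_id (Quat 1 0) mulq.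
Proof. by case=> z w; rewrite /mulq /= !mul1r !mul0r subr0 addr0. Qed.
Fact mulq1 : right_id (Quat 1 0) mulq.
Proof.
move=> [[? ?] [? ?]]; by congr (Quat (_ +i* _) (_ +i* _)); rewrite /=; ring.
Qed.
Fact mulqDl : left_distributive mulq +%R.
Proof.
move=> [[? ?] [? ?]] [[? ?] [? ?]] [[? ?] [? ?]].
by congr (Quat (_ +i* _) (_ +i* _)); rewrite /=; ring.
Qed.
Fact mulqDr : right_distributive mulq +%R.
Proof.
move=> [[? ?] [? ?]] [[? ?] [? ?]] [[? ?] [? ?]].
by congr (Quat (_ +i* _) (_ +i* _)); rewrite /=; ring.
Qed.
Fact oneq_neq0 : Quat 1 0 != 0 :> quat R.
Proof. by apply/eqP => -[] /eqP; rewrite oner_eq0. Qed.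

HB.instance Definition _ := GRing.Zmodule_isNzRing.Build (quat R)
  mulqA mul1q mulq1 mulqDl mulqDr oneq_neq0.

Fact scaleqA a b q : scaleq a (scaleq b q) = scaleq (a * b) q.
Proof. by rewrite /scaleq /= rmorphM !mulrA. Qed.
Fact scale1q : left_id 1 scaleq.
Proof. by case=> z w; rewrite /scaleq rmorph1 !mul1r. Qed.
Fact scaleqDr : right_distributive scaleq +%R.
Proof. by move=> a p q; congr Quat; rewrite /= mulrDr. Qed.
Fact scaleqDl q : {morph scaleq^~ q : a b / a + b}.
Proof. by move=> a b; congr Quat; rewrite /= rmorphD mulrDl. Qed.

HB.instance Definition _ := GRing.Zmodule_isLmodule.Build R (quat R)
  scaleqA scale1q scaleqDr scaleqDl.

Fact scaleqAl a p q : a *: (p * q) = a *: p * q.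
Proof. by congr Quat; rewrite /= ?mulrBr ?mulrDr !mulrA. Qed.

HB.instance Definition _ :=
  GRing.Lmodule_isLalgebra.Build R (quat R) scaleqAl.

Definition qi : quat R := Quat ('i) 0.
Definition qj : quat R := Quat 0 1.
Definition qk : quat R := Quat 0 ('i).

Lemma quat_units :
  [/\ qi * qi = -1, qj * qj = -1, qk * qk = -1, qi * qj = qk & qj * qi = - qk].
Proof. by split; congr (Quat (_ +i* _) (_ +i* _)); rewrite /=; ring. Qed.

End Quaternions.

Arguments qi {R}.
Arguments qj {R}.
Arguments qk {R}.

Definition mx2 (T : Type) (a b c d : T) : 'M[T]_2 :=
  \matrix_(i < 2, j < 2)
    if i == 0 then (if j == 0 then a else b) else (if j == 0 then c else d).

Section Spin41.
Variable R : realType.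

Definition conjCmx m n (A : 'M[R[i]]_(m, n)) : 'M[R[i]]_(m, n) :=
  map_mx (@conjc R) A.

Definition ThetaH (A : 'M[quat R]_2) : 'M[R[i]]_4 :=
  let Z := map_mx (@qz R) A in
  let W := map_mx (@qw R) A in
  (block_mx Z W (- conjCmx W) (conjCmx Z) : 'M[R[i]]_(2 + 2)).

Definition sigma_x : 'M[R[i]]_2 := mx2 0 1 1 0.
Definition sigma_y : 'M[R[i]]_2 := mx2 0 (- 'i) ('i) 0.
Definition sigma_z : 'M[R[i]]_2 := mx2 1 0 0 (-1).

(* onevec m is V_(m+1), m = 0, ..., 4. *)
Definition onevec (m : 'I_5) : 'M[R[i]]_4 :=
  nth 0 [:: (sigma_z *t sigma_x : 'M[R[i]]_(2 * 2));
            (sigma_y *t (1%:M : 'M[R[i]]_2) : 'M[R[i]]_(2 * 2));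
            (sigma_z *t sigma_z : 'M[R[i]]_(2 * 2));
            (sigma_x *t (1%:M : 'M[R[i]]_2) : 'M[R[i]]_(2 * 2));
            - (sigma_z *t ('i *: sigma_y) : 'M[R[i]]_(2 * 2))] m.

Definition Mform : 'M[R[i]]_4 :=
  (block_mx ('i *: sigma_y) 0 0 (- ('i *: sigma_y)) : 'M[R[i]]_(2 + 2)).

Definition Spin41 : set 'M[R[i]]_4 :=
  range ThetaH `&` [set X | (conjCmx X)^T *m Mform *m X = Mform].

(* The matrix, in the basis onevec, of conjugation by ThetaH Y: its n-th column
   lists the real coordinates of the image of onevec n.  The onevec m being linearly
   independent, at most one X qualifies. *)
Definition Phi41 (Y : 'M[quat R]_2) : 'M[R]_5 :=
  [get X : 'M[R]_5 | forall n,
     ThetaH Y *m onevec n *m invmx (ThetaH Y) = \sum_m (X m n)%:C *: onevec m].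

Definition Phi41_fiber (X : 'M[R]_5) : set 'M[quat R]_2 :=
  [set Y | Spin41 (ThetaH Y) /\ Phi41 Y = X].

Definition I41 : 'M[R]_5 :=
  diag_mx (\row_(i < 5) if i == ord_max then -1 else 1).

Definition SO41 : set 'M[R]_5 :=
  [set X | X^T *m I41 *m X = I41 /\ \det X = 1].

Definition SO41p : set 'M[R]_5 := connected_component SO41 1%:M.

Definition cosh (x : R) : R := (expR x + expR (- x)) / 2.
Definition sinh (x : R) : R := (expR x - expR (- x)) / 2.

(* The identity except in the principal submatrix on rows and columns (i, j),
   in this order, where it is B; i and j are counted from 1. *)
Definition planar (i j : nat) (B : 'M[R]_2) : 'M[R]_5 :=
  \matrix_(k < 5, l < 5)
    if (k.+1 == i) && (l.+1 == i) then B 0 0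
    else if (k.+1 == i) && (l.+1 == j) then B 0 1
    else if (k.+1 == j) && (l.+1 == i) then B 1 0
    else if (k.+1 == j) && (l.+1 == j) then B 1 1
    else (k == l)%:R.

Definition Rmx (i j : nat) (t : R) : 'M[R]_5 :=
  planar i j (mx2 (cos t) (- sin t) (sin t) (cos t)).

Definition Hmx (i j : nat) (t : R) : 'M[R]_5 :=
  planar i j (mx2 (cosh t) (sinh t) (sinh t) (cosh t)).

Definition givens_factors (t : 10.-tuple R) : seq 'M[R]_5 :=
  [:: Rmx 1 4 t`_0; Rmx 1 3 t`_1; Rmx 1 2 t`_2; Hmx 1 5 t`_3; Rmx 2 4 t`_4;
      Rmx 2 3 t`_5; Hmx 2 5 t`_6; Rmx 3 4 t`_7; Hmx 3 5 t`_8; Hmx 4 5 t`_9].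

End Spin41.

(* Main.v *)
(* Surjectivity: the component [SO41p] lies in the group of proper isometries
   with positive (5,5) entry, which is stable under left multiplication by
   Givens matrices; left Givens factors clear the columns one after the other,
   and a column equal to e_m forces the m-th row to be e_m too.  Only the sign
   of (4,4) is left at the end, and the determinant fixes it.  Replacing the
   first angle by its sum with pi flips the (1,1) entry at a stage where its
   sign is irrelevant, hence a second decomposition.

   Fibers: multiplication by the central i maps the one-vectors and the form M
   into the image of Theta, so that everything takes place in M(2, H).  Two
   elements of a fiber differ by some W commuting with all the one-vectors,
   hence real scalar, and of square 1 because W preserves M. *)
Require Import Defs.
From HB Require Import structures.
From mathcomp Require Import all_boot all_order all_algebra.
From mathcomp Require Import all_classical all_reals all_analysis.
From mathcomp Require Import complex mxtens ring lra.

Set Implicit Arguments.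
Unset Strict Implicit.
Unset Printing Implicit Defensive.

Import Order.TTheory GRing.Theory Num.Theory.
Import numFieldNormedType.Exports.

Local Open Scope classical_set_scope.
Local Open Scope ring_scope.

(** The four positive directions, counted from 0; the negative one is [ord_max]. *)
Local Notation o0 := (@Ordinal 5 0 isT).
Local Notation o1 := (@Ordinal 5 1 isT).
Local Notation o2 := (@Ordinal 5 2 isT).
Local Notation o3 := (@Ordinal 5 3 isT).

(** * Hyperbolic functions; parametrization of the hyperbola and the circle *)

Section Hyperbolic.
Variable R : realType.
Implicit Types s t x y : R.

Lemma cosh0 : cosh 0 = 1 :> R.
Proof. by rewrite /cosh oppr0 expR0 -mulr2n divff ?pnatr_eq0. Qed.

Lemma sinh0 : sinh 0 = 0 :> R.
Proof. by rewrite /sinh oppr0 subrr mul0r. Qed.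

Lemma coshN t : cosh (- t) = cosh t.
Proof. by rewrite /cosh opprK addrC. Qed.

Lemma sinhN t : sinh (- t) = - sinh t.
Proof. by rewrite /sinh opprK -mulNr opprB. Qed.

Lemma coshD s t : cosh (s + t) = cosh s * cosh t + sinh s * sinh t.
Proof. by rewrite /cosh /sinh opprD !expRD; field. Qed.

Lemma sinhD s t : sinh (s + t) = sinh s * cosh t + cosh s * sinh t.
Proof. by rewrite /cosh /sinh opprD !expRD; field. Qed.

Lemma cosh_sqr t : cosh t ^+ 2 = 1 + sinh t ^+ 2.
Proof.
have : expR t * expR (- t) = 1 by rewrite -expRD subrr expR0.
by rewrite /cosh /sinh => h; field: h.
Qed.

Lemma cosh_gt0 t : 0 < cosh t.
Proof. by rewrite divr_gt0// addr_gt0// expR_gt0. Qed.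

(** On this branch (x + y)(x - y) = 1 with both factors positive, so x + y is some e^t and x - y is
    e^(-t). *)
Lemma hyperbola_param x y : 0 < x -> x ^+ 2 - y ^+ 2 = 1 ->
  exists t, x = cosh t /\ y = sinh t.
Proof.
move=> x0 xy1.
have xy_gt0 : 0 < x + y by nra.
exists (ln (x + y)).
have yx : (x + y)^-1 = x - y.
  by apply: (mulfI (lt0r_neq0 xy_gt0)); rewrite divff ?lt0r_neq0// -xy1; ring.
by rewrite /cosh /sinh expRN lnK ?posrE// yx; split; field.
Qed.

Lemma circle_param x y : exists t,
  x = Num.sqrt (x ^+ 2 + y ^+ 2) * cos t /\ y = Num.sqrt (x ^+ 2 + y ^+ 2) * sin t.
Proof.
set r := Num.sqrt _.
have r2 : r ^+ 2 = x ^+ 2 + y ^+ 2 by rewrite sqr_sqrtr// addr_ge0// sqr_ge0.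
have [r0|r_neq0] := eqVneq r 0.
  by exists 0; move: r2; rewrite r0 !mul0r; split; nra.
pose a := x / r; pose b := y / r.
have ab1 : a ^+ 2 + b ^+ 2 = 1.
  by rewrite !expr_div_n -mulrDl -r2 divff// sqrf_eq0.
have a1 : -1 <= a <= 1 by apply/andP; split; nra.
have cosa : cos (acos a) = a by rewrite acosK// in_itv.
have sina : sin (acos a) = `|b|.
  by rewrite sin_acos// -ab1 addrC addKr sqrtr_sqr.
have -> : x = r * a by rewrite mulrC divfK.
have -> : y = r * b by rewrite mulrC divfK.
(* [acos] yields angles of nonnegative sine only; for b < 0 the opposite angle is taken. *)
have [b0|b0] := lerP 0 b.
  by exists (acos a); rewrite cosa sina ger0_norm.
by exists (- acos a); rewrite cosN sinN cosa sina ltr0_norm// opprK.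
Qed.

End Hyperbolic.

(** * Givens matrices as row operations and as isometries *)

Section Planar.
Variable R : realType.
Implicit Types (B C : 'M[R]_2) (X : 'M[R]_5) (i j k l m n : 'I_5) (s t : R).

(** The working rule of the elimination. [planar] counts indices from 1, hence the successors. *)
Lemma planar_mulE i j B X k l : i != j ->
  (planar i.+1 j.+1 B *m X) k l =
    if k == i then B 0 0 * X i l + B 0 1 * X j l
    else if k == j then B 1 0 * X i l + B 1 1 * X j l else X k l.
Proof.
move=> ij; rewrite mxE (bigD1 i)// (bigD1 j) 1?eq_sym//= !mxE !eqSS !eqxx.
have [->|ki] := eqVneq k i; last have [->|kj] := eqVneq k j.
- rewrite eqxx/= (eq_sym (j : nat)) (negbTE ij : (i == j :> nat) = false).
  rewrite big1 ?addr0// => m /andP[mi mj].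
  rewrite !mxE !eqSS eqxx (negbTE mi : (m == i :> nat) = false).
  by rewrite (negbTE mj : (m == j :> nat) = false)/= (negbTE ij : (i == j :> nat) = false)
    eq_sym (negbTE mi) mul0r.
- rewrite !(eq_sym (j : nat)) (negbTE ij : (i == j :> nat) = false) eqxx/=.
  rewrite big1 ?addr0// => m /andP[mi mj].
  rewrite !mxE !eqSS eqxx (negbTE mi : (m == i :> nat) = false) (eq_sym (j : nat)).
  by rewrite (negbTE mj : (m == j :> nat) = false)/= (negbTE ij : (i == j :> nat) = false)
    eq_sym (negbTE mj) mul0r.
- rewrite (negbTE ki : (k == i :> nat) = false) (negbTE kj : (k == j :> nat) = false)/=.
  rewrite !mul0r !add0r (bigD1 k) ?ki//= big1 ?addr0.
    rewrite !mxE !eqSS (negbTE ki : (k == i :> nat) = false).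
    by rewrite (negbTE kj : (k == j :> nat) = false)/= eqxx mul1r.
  move=> m /andP[_ mk].
  rewrite !mxE !eqSS (negbTE ki : (k == i :> nat) = false).
  by rewrite (negbTE kj : (k == j :> nat) = false)/= eq_sym (negbTE mk) mul0r.
Qed.

Lemma planarM i j B C : i != j ->
  planar i.+1 j.+1 B *m planar i.+1 j.+1 C = planar i.+1 j.+1 (B *m C).
Proof.
(* Padding by the identity lets both sides be computed as row operations. *)
move=> ij; rewrite -[planar _ _ C]mulmx1 -[RHS]mulmx1.
apply/matrixP => k l; rewrite !planar_mulE// !eqxx (eq_sym j) (negbTE ij).
have BC a b : (B *m C) a b = B a 0 * C 0 b + B a 1 * C 1 b.
  by rewrite mxE big_ord_recl big_ord1; congr (_ + B _ _ * C _ _); apply: val_inj.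
rewrite !BC; have [//|_] := eqVneq k i; last have [//|_] := eqVneq k j => //.
- by rewrite !mulrDr !mulrDl !mulrA addrACA.
- by rewrite !mulrDr !mulrDl !mulrA addrACA.
Qed.

Lemma planar1 i j : planar i.+1 j.+1 1%:M = 1%:M :> 'M[R]_5.
Proof.
apply/matrixP => k l; rewrite !mxE !eqSS !eqxx/= -!val_eqE/=.
by do ![case: eqP] => //= *; congruence.
Qed.

Lemma mx2M (T : pzRingType) (a b c d e f g h : T) : mx2 a b c d *m mx2 e f g h =
  mx2 (a * e + b * g) (a * f + b * h) (c * e + d * g) (c * f + d * h).
Proof.
apply/matrixP => k l; rewrite !mxE big_ord_recl big_ord1 !mxE/=.
by case: ifP => _; case: ifP.
Qed.

Lemma mx2_1 (T : pzRingType) : 1%:M = mx2 1 0 0 1 :> 'M[T]_2.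
Proof. by apply/matrixP => -[[|[|//]] ?] [[|[|//]] ?]; rewrite !mxE. Qed.

Lemma RmxD i j s t : i != j ->
  Rmx i.+1 j.+1 s *m Rmx i.+1 j.+1 t = Rmx i.+1 j.+1 (s + t).
Proof.
by move=> ij; rewrite planarM// mx2M /Rmx cosD sinD; congr (planar _ _ (mx2 _ _ _ _)); ring.
Qed.

(** The literal 5 is [ord_max.+1] only up to conversion; this form is the one that rewriting
    recognizes in [Hmx]. *)
Lemma planar5_mulE i B X k l : i != ord_max ->
  (planar i.+1 5 B *m X) k l =
    if k == i then B 0 0 * X i l + B 0 1 * X ord_max l
    else if k == ord_max then B 1 0 * X i l + B 1 1 * X ord_max l else X k l.
Proof. exact: (planar_mulE (j := ord_max)). Qed.

Lemma HmxD i s t : i != ord_max ->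
  Hmx i.+1 5 s *m Hmx i.+1 5 t = Hmx i.+1 5 (s + t).
Proof.
move=> im; rewrite /Hmx coshD sinhD (addrC (cosh s * cosh t)).
rewrite [LHS](planarM (j := ord_max))// mx2M.
by congr (planar _ _ (mx2 _ _ _ _)); ring.
Qed.

Lemma Rmx0 i j : Rmx i.+1 j.+1 0 = 1%:M :> 'M[R]_5.
Proof. by rewrite /Rmx cos0 sin0 oppr0 -mx2_1 planar1. Qed.

Lemma Hmx0 i : Hmx i.+1 5 0 = 1%:M :> 'M[R]_5.
Proof. by rewrite /Hmx cosh0 sinh0 -mx2_1; exact: (planar1 i ord_max). Qed.

Lemma RmxK i j t X : i != j -> X = Rmx i.+1 j.+1 t *m (Rmx i.+1 j.+1 (- t) *m X).
Proof. by move=> ij; rewrite mulmxA RmxD// subrr Rmx0 mul1mx. Qed.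

Lemma HmxK i t X : i != ord_max -> X = Hmx i.+1 5 t *m (Hmx i.+1 5 (- t) *m X).
Proof. by move=> im; rewrite mulmxA HmxD// subrr Hmx0 mul1mx. Qed.

Definition eta k : R := if k == ord_max then -1 else 1.

Definition isom41 X := X^T *m I41 R *m X = I41 R.

Lemma isom41E X :
  isom41 X <-> forall m n, \sum_k eta k * (X k m * X k n) = eta m * (m == n)%:R.
Proof.
have XE m n : (X^T *m I41 R *m X) m n = \sum_k eta k * (X k m * X k n).
  rewrite mul_mx_diag mxE; apply: eq_bigr => k _.
  by rewrite !mxE -/(eta k) mulrCA mulrA.
split=> [iX m n|iX]; first by rewrite -XE iX !mxE mulr_natr.
by apply/matrixP => m n; rewrite XE iX !mxE mulr_natr.
Qed.

(** The hypothesis is the bilinear form of [B] preserving the metric of the (i, j) plane; the other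
    rows contribute the same terms before and after. *)
Lemma isom41_planar i j B X : i != j ->
    (forall x y z t, eta i * ((B 0 0 * x + B 0 1 * y) * (B 0 0 * z + B 0 1 * t)) +
                     eta j * ((B 1 0 * x + B 1 1 * y) * (B 1 0 * z + B 1 1 * t))
                     = eta i * (x * z) + eta j * (y * t)) ->
  isom41 X -> isom41 (planar i.+1 j.+1 B *m X).
Proof.
move=> ij BP /isom41E iX; apply/isom41E => m n; rewrite -iX.
rewrite (bigD1 i)// (bigD1 j) 1?eq_sym//= [RHS](bigD1 i)// [X in _ = _ + X](bigD1 j) 1?eq_sym//=.
rewrite !addrA; congr (_ + _); last first.
  by apply: eq_bigr => k /andP[ki kj]; rewrite !planar_mulE// (negbTE ki) (negbTE kj).
by rewrite !planar_mulE// !eqxx (eq_sym j) (negbTE ij).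
Qed.

Lemma isom41_Rmx i j t X : i != j -> i != ord_max -> j != ord_max ->
  isom41 X -> isom41 (Rmx i.+1 j.+1 t *m X).
Proof.
move=> ij im jm; apply: isom41_planar => // x y z u.
by rewrite !mxE/= /eta (negbTE im) (negbTE jm); have h := cos2sin2 t; ring: h.
Qed.

Lemma isom41_Hmx i t X : i != ord_max ->
  isom41 X -> isom41 (Hmx i.+1 5 t *m X).
Proof.
move=> im; apply: (isom41_planar (j := ord_max)) => // x y z u.
by rewrite !mxE/= /eta (negbTE im) eqxx; have h := cosh_sqr t; ring: h.
Qed.

Lemma isom41_det X : isom41 X -> \det X * \det X = 1.
Proof.
have dI : \det (I41 R) != 0.
  rewrite det_diag; apply/prodf_neq0 => k _; rewrite mxE.
  by case: ifP; rewrite ?oppr_eq0 oner_eq0.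
move/(congr1 determinant); rewrite !det_mulmx det_tr mulrAC.
by rewrite -{2}[\det (I41 R)]mul1r => /(mulIf dI).
Qed.

Lemma isom41_1 : isom41 1%:M.
Proof. by rewrite /isom41 trmx1 mul1mx mulmx1. Qed.

(* A one-parameter subgroup consists of squares. *)
Lemma det_Rmx i j t : i != j -> i != ord_max -> j != ord_max ->
  \det (Rmx i.+1 j.+1 t) = 1.
Proof.
move=> ij im jm; have := isom41_Rmx (t / 2) ij im jm isom41_1.
by rewrite mulmx1 => /isom41_det; rewrite -det_mulmx RmxD// -splitr.
Qed.

Lemma det_Hmx i t : i != ord_max -> \det (Hmx i.+1 5 t) = 1.
Proof.
move=> im; have := isom41_Hmx (t / 2) im isom41_1.
by rewrite mulmx1 => /isom41_det; rewrite -det_mulmx HmxD// -splitr.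
Qed.

End Planar.

(** * Clearing entries with a single Givens matrix *)

Section GivensReduction.
Variable R : realType.
Implicit Types (X Y : 'M[R]_5) (i j k l m n : 'I_5) (t : R).

(* In fact the identity component [SO41p R]; only one inclusion is needed. *)
Definition proper41 X := [/\ isom41 X, \det X = 1 & 0 < X ord_max ord_max].

Lemma col_norm X m : isom41 X -> \sum_k eta R k * X k m ^+ 2 = eta R m.
Proof.
by move/isom41E => /(_ m m); rewrite eqxx mulr1 => <-; apply: eq_bigr => k _; rewrite expr2.
Qed.

(** The last column has square -1, so the square of its last entry is 1 plus the sum of the other
    squares. *)
Lemma last_col_lt X i : isom41 X -> i != ord_max ->
  X i ord_max ^+ 2 < X ord_max ord_max ^+ 2.
Proof.
move=> /(col_norm ord_max) + im; rewrite (bigD1 ord_max)// (bigD1 i)//=.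
set S := \sum_(_ < _ | _) _; have : 0 <= S.
  apply: sumr_ge0 => k /andP[km _].
  by rewrite /eta (negbTE km) mul1r sqr_ge0.
by rewrite /eta eqxx (negbTE im) => S0 h; nra.
Qed.

Lemma proper41_Rmx i j t X : i != j -> i != ord_max -> j != ord_max ->
  proper41 X -> proper41 (Rmx i.+1 j.+1 t *m X).
Proof.
move=> ij im jm [iX dX X0]; split; first exact: isom41_Rmx.
  by rewrite det_mulmx det_Rmx// mul1r.
by rewrite planar_mulE// 2!(eq_sym ord_max) (negbTE im) (negbTE jm).
Qed.

(** The new (5,5) entry is sinh t * x + cosh t * y with |x| < y and |sinh t| < cosh t, so its second
    term dominates. *)
Lemma proper41_Hmx i t X : i != ord_max ->
  proper41 X -> proper41 (Hmx i.+1 5 t *m X).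
Proof.
move=> im [iX dX X0]; split; first exact: isom41_Hmx.
  by rewrite det_mulmx det_Hmx// mul1r.
rewrite planar5_mulE// eq_sym (negbTE im) eqxx !mxE/=.
have := last_col_lt iX im; set x := X i _; set y := X _ _ => xy.
move: (cosh t) (sinh t) (cosh_gt0 t) (cosh_sqr t) => c s c0 c2.
(* Otherwise c y <= - s x; squaring, with c^2 = 1 + s^2 and x^2 < y^2, gives y^2 <= 0, which is
   absurd. *)
rewrite -ltrBlDl sub0r ltNge; apply/negP => yx.
have : (c * y) ^+ 2 <= (- (s * x)) ^+ 2.
  by rewrite lerXn2r// ?nnegrE ?(le_trans _ yx)// mulr_ge0// ltW.
have := ler_wpM2l (sqr_ge0 s) (ltW xy).
have x2 := sqr_ge0 x.
by rewrite sqrrN !exprMn c2 mulrDl mul1r; lra.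
Qed.

(** X splits off a 1x1 block equal to 1, which Givens matrices on other indices leave alone. *)
Definition fixed41 m X := (forall k, X k m = (k == m)%:R) /\ (forall k, X m k = (m == k)%:R).

Lemma fixed41_planar i j B X m : i != j -> m != i -> m != j ->
  fixed41 m X -> fixed41 m (planar i.+1 j.+1 B *m X).
Proof.
move=> ij mi mj [Xc Xr]; split=> k; rewrite planar_mulE//;
  last by rewrite (negbTE mi) (negbTE mj) Xr.
rewrite !Xc (eq_sym i) (eq_sym j) (negbTE mi) (negbTE mj) !mulr0 addr0.
by case: eqVneq => [->|_]; [|case: eqVneq => [->|//]]; rewrite eq_sym ?(negbTE mi) ?(negbTE mj).
Qed.

(** In the product of columns i and k only the term e * X i k survives. The sign e stays free for
    the last elimination step, where it is not yet known. *)
Lemma isom41_row X i e : isom41 X -> i != ord_max -> e * e = 1 ->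
  (forall k, X k i = e * (k == i)%:R) -> forall k, X i k = e * (i == k)%:R.
Proof.
move=> /isom41E iX im e1 Xc k; have := iX i k.
rewrite (bigD1 i)//= big1 ?addr0 => [|l li]; last by rewrite Xc (negbTE li) mulr0 mul0r mulr0.
rewrite Xc eqxx mulr1 /eta (negbTE im) !mul1r => /(congr1 ( *%R e)).
by rewrite mulrA e1 mul1r.
Qed.

(** The angle is the polar angle of the entries (i, n) and (j, n), which become (r, 0). The last
    clause serves to carry over zeros and fixed directions obtained earlier. *)
Lemma Rmx_kill i j n X : i != j -> i != ord_max -> j != ord_max -> proper41 X ->
  exists t Y, [/\ X = Rmx i.+1 j.+1 t *m Y, proper41 Y,
     Y j n = 0, 0 <= Y i n
   & exists B, Y = planar i.+1 j.+1 B *m X].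
Proof.
move=> ij im jm pX; have [t [Xi Xj]] := circle_param (X i n) (X j n).
exists t, (Rmx i.+1 j.+1 (- t) *m X); split.
- exact: RmxK.
- exact: proper41_Rmx.
- rewrite planar_mulE// eqxx eq_sym (negbTE ij) !mxE/= cosN sinN Xj {1}Xi.
  by ring.
- rewrite planar_mulE// eqxx !mxE/= cosN sinN opprK Xj {1}Xi.
  rewrite mulrCA [X in _ + X]mulrCA -mulrDr -!expr2 cos2Dsin2 mulr1.
  exact: sqrtr_ge0.
- by exists (mx2 (cos (- t)) (- sin (- t)) (sin (- t)) (cos (- t))).
Qed.

(** Column i lives on rows i and 5, so its entries x, y satisfy x^2 - y^2 = 1. A hyperbolic rotation
    cannot change the branch, so the sign of x remains. *)
Lemma Hmx_kill i X : i != ord_max -> proper41 X ->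
    (forall k, k != i -> k != ord_max -> X k i = 0) ->
  exists t Y, [/\ X = Hmx i.+1 5 t *m Y, proper41 Y,
     forall k, Y k i = Num.sg (X i i) * (k == i)%:R,
     X i i != 0
   & exists B, Y = planar i.+1 5 B *m X].
Proof.
move=> im pX X0; have [iX _ _] := pX.
have : X i i ^+ 2 - X ord_max i ^+ 2 = 1.
  have := col_norm i iX; rewrite (bigD1 i)//= (bigD1 ord_max) 1?eq_sym//=.
  rewrite big1 => [|k /andP[ki km]]; last by rewrite X0// expr0n mulr0.
  by rewrite /eta eqxx (negbTE im) addr0 mul1r mulN1r.
set x := X i i; set y := X _ _ => xy1.
have x_neq0 : x != 0 by apply: contra_eq_neq xy1 => ->; apply/eqP; nra.
have sg2 : Num.sg x * Num.sg x = 1 by rewrite -expr2 sqr_sg x_neq0.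
(* Multiplying by the sign of x moves the point to the branch x > 0. *)
have [||t [xt yt]] := @hyperbola_param R (Num.sg x * x) (Num.sg x * y).
- by rewrite -normrEsg normr_gt0.
- by rewrite !exprMn expr2 sg2 !mul1r.
have xE : x = Num.sg x * cosh t by rewrite -xt mulrA sg2 mul1r.
have yE : y = Num.sg x * sinh t by rewrite -yt mulrA sg2 mul1r.
exists t, (Hmx i.+1 5 (- t) *m X); split=> //.
- exact: HmxK.
- exact: proper41_Hmx.
- move=> k; rewrite planar5_mulE// !mxE/= coshN sinhN -/x -/y.
  have c2 := cosh_sqr t.
  have [_|ki] := eqVneq k i; first by rewrite {1}xE yE mulr1n; ring: c2.
  have [_|km] := eqVneq k ord_max; first by rewrite {1}xE yE mulr0n; ring.
  by rewrite X0// mulr0.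
- by exists (mx2 (cosh (- t)) (sinh (- t)) (sinh (- t)) (cosh (- t))).
Qed.

(** The nonnegative pivot left by the preceding rotation excludes the sign -1. *)
Lemma Hmx_fix i X : i != ord_max -> proper41 X -> 0 <= X i i ->
    (forall k, k != i -> k != ord_max -> X k i = 0) ->
  exists t Y, [/\ X = Hmx i.+1 5 t *m Y, proper41 Y, fixed41 i Y
   & exists B, Y = planar i.+1 5 B *m X].
Proof.
move=> im pX X0 Xz; have [t [Y [XE pY Yc Xn0 BE]]] := Hmx_kill im pX Xz.
have sg1 : Num.sg (X i i) = 1 by rewrite gtr0_sg// lt_neqAle eq_sym Xn0.
have [iY _ _] := pY; exists t, Y; split=> //; split=> k.
  by rewrite Yc sg1 mul1r.
by rewrite (isom41_row iY im (mulr1 1))// ?mul1r// => l; rewrite Yc sg1.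
Qed.

End GivensReduction.

(** * The ten-factor decomposition and its non-uniqueness *)

Section GivensDecomposition.
Variable R : realType.
Implicit Types (X Y : 'M[R]_5) (t : R).

Lemma ord5_ind (P : 'I_5 -> Prop) :
  P o0 -> P o1 -> P o2 -> P o3 -> P ord_max -> forall k, P k.
Proof.
move=> P0 P1 P2 P3 P4 [[|[|[|[|[|//]]]]] k5].
- by rewrite (_ : Ordinal k5 = o0)//; exact: val_inj.
- by rewrite (_ : Ordinal k5 = o1)//; exact: val_inj.
- by rewrite (_ : Ordinal k5 = o2)//; exact: val_inj.
- by rewrite (_ : Ordinal k5 = o3)//; exact: val_inj.
- by rewrite (_ : Ordinal k5 = ord_max)//; exact: val_inj.
Qed.

(** No rotation has adjusted the pivot here: the remainder is diag(1, 1, 1, e, 1), of determinant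
    e. *)
Lemma H45_decomposition X : proper41 X ->
  fixed41 o0 X -> fixed41 o1 X -> fixed41 o2 X -> exists t, X = Hmx 4 5 t.
Proof.
move=> pX [c0 r0] [c1 r1] [c2 r2].
have Xz k : k != o3 -> k != ord_max -> X k o3 = 0.
  by elim/ord5_ind: k => // _ _; rewrite ?r0 ?r1 ?r2.
have [t [Y [XE [iY dY Y0] Yc X3 [B YE]]]] := @Hmx_kill R o3 X isT pX Xz.
exists t; rewrite XE.
set e := Num.sg (X o3 o3) in Yc.
have e2 : e * e = 1 by rewrite -expr2 sqr_sg X3.
have fY m : m != o3 -> m != ord_max -> fixed41 m X -> fixed41 m Y.
  by move=> m3 m4 fX; rewrite YE; apply: (fixed41_planar (j := ord_max)).
have [Yc0 Yr0] : fixed41 o0 Y by apply: fY.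
have [Yc1 Yr1] : fixed41 o1 Y by apply: fY.
have [Yc2 Yr2] : fixed41 o2 Y by apply: fY.
have Yr3 := @isom41_row R Y o3 e iY isT e2 Yc.
(* The first four rows vanish in the last column, so this entry has square 1; it is also
   positive. *)
have Y44 : Y ord_max ord_max = 1.
  have := col_norm ord_max iY; rewrite (bigD1 ord_max)//= big1.
    rewrite /eta eqxx addr0 mulN1r => /oppr_inj Y1.
    by apply/eqP; rewrite -(@eqrXn2 _ 2)// ?expr1n ?Y1// ltW.
  by elim/ord5_ind => // _; rewrite ?Yr0 ?Yr1 ?Yr2 ?Yr3/= ?mulr0n ?mulr0 expr0n/= mulr0.
pose d := \row_(k < 5) if k == o3 then e else 1.
have YD : Y = diag_mx d.
  apply/matrixP => k l; rewrite !mxE; elim/ord5_ind: k.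
  - by rewrite Yr0.
  - by rewrite Yr1.
  - by rewrite Yr2.
  - by rewrite Yr3 mulr_natr.
  - by elim/ord5_ind: l; rewrite ?Yc0 ?Yc1 ?Yc2 ?Yc ?Y44//= mulr0.
have e1 : e = 1.
  move: dY; rewrite YD det_diag (bigD1 o3)//= big1 => [|k k3].
    by rewrite mxE eqxx mulr1.
  by rewrite mxE (negbTE k3).
suff -> : Y = 1%:M by rewrite mulmx1.
by rewrite YD -diag_const_mx; congr diag_mx; apply/rowP => k; rewrite !mxE e1 if_same.
Qed.

(** The (4,1) entry is already cleared, so t is free. R13, R12, H15 finish column 1, R24, R23, H25
    column 2, R34, H35 column 3, and H45 is what remains. *)
Lemma givens9_decomposition X : proper41 X -> X o3 o0 = 0 ->
  exists s : 9.-tuple R, forall t,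
    Rmx 1 4 t *m X = \prod_(A <- givens_factors [tuple of t :: s]) A.
Proof.
move=> pX X30.
have [t1 [X1 [X1E pX1 X1_20 _ [B1 X1B]]]] := @Rmx_kill R o0 o2 o0 X isT isT isT pX.
(* R13 leaves row 4 alone. *)
have X1_30 : X1 o3 o0 = 0 by rewrite X1B planar_mulE.
have [t2 [X2 [X2E pX2 X2_10 X2_00 [B2 X2B]]]] := @Rmx_kill R o0 o1 o0 X1 isT isT isT pX1.
have X2z k : k != o0 -> k != ord_max -> X2 k o0 = 0.
  by elim/ord5_ind: k => // _ _; rewrite ?X2_10// X2B planar_mulE.
have [t3 [X3 [X3E pX3 f0X3 _]]] := @Hmx_fix R o0 X2 isT pX2 X2_00 X2z.
have [t4 [X4 [X4E pX4 X4_31 _ [B4 X4B]]]] := @Rmx_kill R o1 o3 o1 X3 isT isT isT pX3.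
have f0X4 : fixed41 o0 X4 by rewrite X4B; exact: fixed41_planar.
have [t5 [X5 [X5E pX5 X5_21 X5_11 [B5 X5B]]]] := @Rmx_kill R o1 o2 o1 X4 isT isT isT pX4.
have f0X5 : fixed41 o0 X5 by rewrite X5B; exact: fixed41_planar.
have X5z k : k != o1 -> k != ord_max -> X5 k o1 = 0.
  elim/ord5_ind: k => // _ _; first by rewrite (proj2 f0X5).
  by rewrite X5B planar_mulE.
have [t6 [X6 [X6E pX6 f1X6 [B6 X6B]]]] := @Hmx_fix R o1 X5 isT pX5 X5_11 X5z.
have f0X6 : fixed41 o0 X6 by rewrite X6B; exact: (fixed41_planar (j := ord_max)).
have [t7 [X7 [X7E pX7 X7_32 X7_22 [B7 X7B]]]] := @Rmx_kill R o2 o3 o2 X6 isT isT isT pX6.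
have f0X7 : fixed41 o0 X7 by rewrite X7B; exact: fixed41_planar.
have f1X7 : fixed41 o1 X7 by rewrite X7B; exact: fixed41_planar.
have X7z k : k != o2 -> k != ord_max -> X7 k o2 = 0.
  by elim/ord5_ind: k => // _ _; rewrite ?(proj2 f0X7) ?(proj2 f1X7).
have [t8 [X8 [X8E pX8 f2X8 [B8 X8B]]]] := @Hmx_fix R o2 X7 isT pX7 X7_22 X7z.
have f0X8 : fixed41 o0 X8 by rewrite X8B; exact: (fixed41_planar (j := ord_max)).
have f1X8 : fixed41 o1 X8 by rewrite X8B; exact: (fixed41_planar (j := ord_max)).
have [t9 X9E] := H45_decomposition pX8 f0X8 f1X8 f2X8.
exists [tuple t1; t2; t3; t4; t5; t6; t7; t8; t9] => t.
rewrite /givens_factors !big_cons big_nil mulr1 -!mulmxE.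
by rewrite X1E X2E X3E X4E X5E X6E X7E X8E X9E.
Qed.

Lemma givens_decomposition_nonunique X : proper41 X ->
  exists s t : 10.-tuple R,
    [/\ X = \prod_(A <- givens_factors s) A,
        X = \prod_(A <- givens_factors t) A
      & givens_factors s <> givens_factors t].
Proof.
move=> pX; have [t [Y [XE pY Y30 _ _]]] := @Rmx_kill R o0 o3 o0 X isT isT isT pX.
(* The half turn negates rows 1 and 4, so the zero at (4,1) survives. *)
pose Y' := Rmx 1 4 (- pi) *m Y.
have pY' : proper41 Y' by apply: (@proper41_Rmx R o0 o3).
have XE' : X = Rmx 1 4 (t + pi) *m Y'.
  by rewrite mulmxA (@RmxD R o0 o3)// addrK XE.
have Y'30 : Y' o3 o0 = 0.
  by rewrite (@planar_mulE R o0 o3)//= !mxE/= Y30 sinN sinpi oppr0 mul0r mulr0 addr0.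
have [s sE] := givens9_decomposition pY Y30.
have [s' s'E] := givens9_decomposition pY' Y'30.
exists [tuple of t :: s], [tuple of (t + pi) :: s']; split.
- by rewrite -sE.
- by rewrite -s'E.
- move=> /(congr1 (head 1%:M)) /= E.
  have /matrixP /(_ o0 o0) := E; have /matrixP /(_ o3 o0) := E.
  rewrite !mxE/= cosDpi sinDpi => s0 c0.
  by have := cos2Dsin2 t; nra.
Qed.

(** On [SO41] the (5,5) entry has square at least 1, so it never vanishes; being continuous and
    equal to 1 at the identity, it stays positive on the component. *)
Lemma SO41p_proper X : SO41p X -> proper41 X.
Proof.
move=> XC; have [iX dX] := connected_component_sub XC; split=> //.
have sqr_ge1 Y : SO41 Y -> 1 <= Y ord_max ord_max ^+ 2.
  move=> [/(col_norm ord_max) + _]; rewrite (bigD1 ord_max)//=.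
  rewrite /eta eqxx mulN1r => iY; rewrite -lerN2 -iY lerDl.
  by apply: sumr_ge0 => k km; rewrite (negbTE km) mul1r sqr_ge0.
pose f (Y : 'M[R]_5) := Y ord_max ord_max.
have fC : continuous f by exact: coord_continuous.
have conn := connected_continuous_connected
  (@component_connected _ (@SO41 R) (1%:M : 'M[R]_5)) (continuous_subspaceT fC).
have I1 : SO41p (1%:M : 'M[R]_5).
  by apply: connected_component_refl; split; [exact: isom41_1 | exact: det1].
have /connected_intervalP itv := conn; rewrite ltNge; apply/negP => X0.
have [|Y YC Y0] := itv (f X) (f 1%:M) (ex_intro2 _ _ X XC erefl)
  (ex_intro2 _ _ 1%:M I1 erefl) 0.
  by rewrite X0 /f mxE eqxx ler01.
have := sqr_ge1 _ (connected_component_sub YC).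
by rewrite -/(f Y) Y0 expr0n/= ler10.
Qed.

End GivensDecomposition.

(** * One-vectors and adjoints inside M(2, H) *)

Section QuaternionicModel.
Variable R : realType.
Local Open Scope complex_scope.
Implicit Types (a b c d e : R) (A Y W : 'M[quat R]_2) (X : 'M[R]_5) (x : 'I_5 -> R).

(* a + b i + c j + d k *)
Definition qr a b c d : quat R := Quat (a +i* b) (c +i* d).

Lemma quatE (q : quat R) : exists a b c d, q = qr a b c d.
Proof. by case: q => -[a b] [c d]; exists a, b, c, d. Qed.

Lemma qrD a b c d a' b' c' d' :
  qr a b c d + qr a' b' c' d' = qr (a + a') (b + b') (c + c') (d + d').
Proof. by []. Qed.

Lemma qrN a b c d : - qr a b c d = qr (- a) (- b) (- c) (- d).
Proof. by []. Qed.

Lemma qrM a b c d a' b' c' d' : qr a b c d * qr a' b' c' d' =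
  qr (a * a' - b * b' - c * c' - d * d') (a * b' + b * a' + c * d' - d * c')
     (a * c' - b * d' + c * a' + d * b') (a * d' + b * c' - c * b' + d * a').
Proof. by congr (Quat (_ +i* _) (_ +i* _)); rewrite /=; ring. Qed.

Lemma qr0 : 0 = qr 0 0 0 0. Proof. by []. Qed.

Lemma qr1 : 1 = qr 1 0 0 0. Proof. by []. Qed.

Lemma qrZ s a b c d : s *: qr a b c d = qr (s * a) (s * b) (s * c) (s * d).
Proof. by congr (Quat (_ +i* _) (_ +i* _)); rewrite /=; ring. Qed.

Lemma qrA a : a%:A = qr a 0 0 0.
Proof. by rewrite qr1 qrZ mulr1 mulr0. Qed.

Lemma qr_inj a b c d a' b' c' d' : qr a b c d = qr a' b' c' d' ->
  [/\ a = a', b = b', c = c' & d = d'].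
Proof. by case. Qed.

Definition qconj (q : quat R) : quat R := Quat (conjc (qz q)) (- qw q).

Lemma qconj_qr a b c d : qconj (qr a b c d) = qr a (- b) (- c) (- d).
Proof. by []. Qed.

Lemma mx2E (T : Type) (A : 'M[T]_2) : A = mx2 (A 0 0) (A 0 1) (A 1 0) (A 1 1).
Proof.
apply/matrixP => -[[|[|//]] i2] [[|[|//]] j2]; rewrite !mxE/=; congr (A _ _); exact: val_inj.
Qed.

Lemma mx2_inj (T : Type) (a b c d a' b' c' d' : T) :
  mx2 a b c d = mx2 a' b' c' d' -> [/\ a = a', b = b', c = c' & d = d'].
Proof.
move=> /matrixP E; have := (E 0 0, E 0 1, E 1 0, E 1 1).
by rewrite !mxE/= => -[[[]]].
Qed.

(** The quaternionic adjoint, which [ThetaH] turns into the complex conjugate transpose. *)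
Definition dagger A : 'M[quat R]_2 := (map_mx qconj A)^T.

Lemma dagger_mx2 p q r s :
  dagger (mx2 p q r s) = mx2 (qconj p) (qconj r) (qconj q) (qconj s).
Proof. by apply/matrixP => -[[|[|//]] i2] [[|[|//]] j2]; rewrite !mxE. Qed.

Lemma block_mx22_eq (T : Type) (A B C D A' B' C' D' : 'M[T]_2) :
  A = A' -> B = B' -> C = C' -> D = D' ->
  block_mx A B C D = block_mx A' B' C' D' :> 'M[T]_4.
Proof. by move=> -> -> -> ->. Qed.

Lemma qzD p q : qz (p + q) = qz p + qz q :> R[i]. Proof. by []. Qed.

Lemma qwD p q : qw (p + q) = qw p + qw q :> R[i]. Proof. by []. Qed.

Lemma qzM p q : qz (p * q) = qz p * qz q - qw p * conjc (qw q) :> R[i]. Proof. by []. Qed.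

Lemma qwM p q : qw (p * q) = qz p * qw q + qw p * conjc (qz q) :> R[i]. Proof. by []. Qed.

Lemma ThetaHM A B : ThetaH (A *m B) = ThetaH A *m ThetaH B.
Proof.
rewrite /ThetaH /= [RHS](@mulmx_block _ 2 2 2 2 2 2).
apply: block_mx22_eq; apply/matrixP => i j; rewrite !mxE !big_ord_recl !big_ord0 !mxE.
- by rewrite !addr0 !qzD !qzM; ring.
- by rewrite !addr0 !qwD !qwM; ring.
- by rewrite !addr0 !qwD !qwM !rmorphD/= !rmorphM/= !conjcK; ring.
- by rewrite !addr0 !qzD !qzM !rmorphD/= !rmorphN/= !rmorphM/= !conjcK; ring.
Qed.

Lemma ThetaH_inj : injective (@ThetaH R).
Proof.
move=> A B /(@eq_block_mx _ 2 2 2 2)[/matrixP Z /matrixP W _ _]; apply/matrixP => i j.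
by have := (Z i j, W i j); rewrite !mxE; case: (A i j) (B i j) => [? ?] [? ?] /= [-> ->].
Qed.

Lemma ThetaH1 : ThetaH 1%:M = 1%:M :> 'M[R[i]]_4.
Proof.
rewrite /ThetaH /=; apply: etrans (esym (scalar_mx_block 2 2 (1 : R[i]))).
apply: block_mx22_eq; apply/matrixP => -[[|[|//]] i2] [[|[|//]] j2]; rewrite !mxE /=.
all: try by rewrite ?mulr1n ?mulr0n/= ?oppr0.
all: try by apply/eqP; rewrite ?mulr1n ?mulr0n eq_complex/= ?oppr0 ?eqxx.
Qed.

Lemma ThetaH_dagger A : ThetaH (dagger A) = (conjCmx (ThetaH A))^T.
Proof.
rewrite /ThetaH /= /conjCmx (@map_block_mx _ _ _ 2 2 2 2) (@tr_block_mx _ 2 2 2 2).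
apply: block_mx22_eq; apply/matrixP => i j; rewrite !mxE.
all: case: (A j i) => -[? ?] [? ?]; rewrite /= ?opprK.
by [].
by [].
by apply/eqP; rewrite eq_complex/= opprK !eqxx.
by [].
Qed.

(* The quaternionic matrix of i (a V_1 + b V_2 + c V_3 + d V_4 + e V_5). *)
Definition hvec a b c d e : 'M[quat R]_2 :=
  mx2 (qr 0 c b d) (qr 0 (a - e) 0 0) (qr 0 (a + e) 0 0) (qr 0 (- c) b d).

Lemma tens_mx2 (a b c d : R[i]) (B : 'M[R[i]]_2) :
  mx2 a b c d *t B = block_mx (a *: B) (b *: B) (c *: B) (d *: B).
Proof.
apply/matrixP => i j.
case: (split_ordP i) => i' ->; case: (split_ordP j) => j' ->.
- apply: etrans (esym (block_mxEul _ _ _ _ _ _)); rewrite !mxE.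
  case: i' j' => -[|[|//]] ? [[|[|//]] ?] /=;
  by congr (_ * fun_of_matrix _ _ _); exact: val_inj.
- apply: etrans (esym (block_mxEur _ _ _ _ _ _)); rewrite !mxE.
  case: i' j' => -[|[|//]] ? [[|[|//]] ?] /=;
  by congr (_ * fun_of_matrix _ _ _); exact: val_inj.
- apply: etrans (esym (block_mxEdl _ _ _ _ _ _)); rewrite !mxE.
  case: i' j' => -[|[|//]] ? [[|[|//]] ?] /=;
  by congr (_ * fun_of_matrix _ _ _); exact: val_inj.
- apply: etrans (esym (block_mxEdr _ _ _ _ _ _)); rewrite !mxE.
  case: i' j' => -[|[|//]] ? [[|[|//]] ?] /=;
  by congr (_ * fun_of_matrix _ _ _); exact: val_inj.
Qed.

Lemma sum5 (V : nmodType) (F : 'I_5 -> V) :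
  \sum_m F m = F o0 + F o1 + F o2 + F o3 + F ord_max.
Proof.
rewrite !big_ord_recl big_ord0 addr0 !addrA.
by congr (F _ + F _ + F _ + F _ + F _); apply: val_inj.
Qed.

Lemma mx2D (V : nmodType) (a b c d a' b' c' d' : V) :
  mx2 a b c d + mx2 a' b' c' d' = mx2 (a + a') (b + b') (c + c') (d + d').
Proof. by apply/matrixP => i j; rewrite !mxE; do 2 case: ifP. Qed.

Lemma mx2N (V : zmodType) (a b c d : V) : - mx2 a b c d = mx2 (- a) (- b) (- c) (- d).
Proof. by apply/matrixP => i j; rewrite !mxE; do 2 case: ifP. Qed.

Lemma mx2Z (T : pzRingType) (s a b c d : T) :
  s *: mx2 a b c d = mx2 (s * a) (s * b) (s * c) (s * d).
Proof. by apply/matrixP => i j; rewrite !mxE; do 2 case: ifP. Qed.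

Lemma mx2_map (T U : Type) (f : T -> U) (a b c d : T) :
  map_mx f (mx2 a b c d) = mx2 (f a) (f b) (f c) (f d).
Proof. by apply/matrixP => i j; rewrite !mxE; do 2 case: ifP. Qed.

Definition hvecf x := hvec (x o0) (x o1) (x o2) (x o3) (x ord_max).

(** The lower blocks of a one-vector are the opposites of what the image of [ThetaH] requires; the
    factor i, conjugated to -i, repairs the sign. *)
Lemma ThetaH_hvec x : ThetaH (hvecf x) = 'i *: \sum_m (x m)%:C *: onevec R m.
Proof.
rewrite sum5 /onevec /= !tens_mx2 (@opp_block_mx _ 2 2 2 2).
do 5 rewrite (@scale_block_mx _ 2 2 2 2).
do 4 rewrite (@add_block_mx _ 2 2 2 2).
rewrite (@scale_block_mx _ 2 2 2 2).
rewrite /ThetaH /= /conjCmx /hvecf /hvec !mx2_map /= /sigma_x /sigma_y /sigma_z !mx2_1.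
rewrite !(mx2Z, mx2N, mx2D).
apply: block_mx22_eq; congr mx2.
all: apply/eqP; rewrite eq_complex/=; apply/andP; split; apply/eqP; ring.
Qed.

Lemma Mform_onevec : Mform R = - onevec R ord_max.
Proof.
by rewrite /onevec /= opprK tens_mx2 scale1r scaleN1r scale0r.
Qed.

End QuaternionicModel.

(** * Fibers of the covering map *)

Section Fibers.
Variable R : realType.
Local Open Scope complex_scope.
Implicit Types (a b c d e : R) (A B Y W : 'M[quat R]_2) (X : 'M[R]_5).

Lemma hvecM a b c d e p q r s : hvec a b c d e *m mx2 p q r s =
  mx2 (qr 0 c b d * p + qr 0 (a - e) 0 0 * r) (qr 0 c b d * q + qr 0 (a - e) 0 0 * s)
      (qr 0 (a + e) 0 0 * p + qr 0 (- c) b d * r) (qr 0 (a + e) 0 0 * q + qr 0 (- c) b d * s).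
Proof. exact: mx2M. Qed.

Lemma mulmx_hvec a b c d e p q r s : mx2 p q r s *m hvec a b c d e =
  mx2 (p * qr 0 c b d + q * qr 0 (a + e) 0 0) (p * qr 0 (a - e) 0 0 + q * qr 0 (- c) b d)
      (r * qr 0 c b d + s * qr 0 (a + e) 0 0) (r * qr 0 (a - e) 0 0 + s * qr 0 (- c) b d).
Proof. exact: mx2M. Qed.

(** The quaternionic matrix of i M, as M = -V_5. *)
Definition Mquat : 'M[quat R]_2 := hvec 0 0 0 0 (-1).

Lemma Mquat_sqr : Mquat *m Mquat = 1%:M.
Proof.
rewrite hvecM mx2_1 qr0 qr1 !(qrM, qrD).
by congr mx2; congr qr; ring.
Qed.

Lemma imag_neq0 : 'i != 0 :> R[i].
Proof. by apply/eqP => -[] /eqP; rewrite oner_eq0. Qed.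

Lemma ThetaH_Mquat : ThetaH Mquat = 'i *: Mform R.
Proof.
rewrite Mform_onevec (ThetaH_hvec (fun m => if m == ord_max then -1 else 0)).
by rewrite sum5 !scale0r !add0r rmorphN1 scaleN1r.
Qed.

Lemma ThetaH_onevec n :
  ThetaH (hvecf (fun m => (m == n)%:R)) = 'i *: onevec R n.
Proof.
rewrite ThetaH_hvec (bigD1 n)//= big1 => [|m /negbTE ->]; last by rewrite scale0r.
by rewrite eqxx scale1r addr0.
Qed.

(** Multiplied by i, the defining equation lies in the image of the injective [ThetaH]. *)
Lemma Spin41P Y : Spin41 (ThetaH Y) <-> dagger Y *m Mquat *m Y = Mquat.
Proof.
have E : 'i *: ((conjCmx (ThetaH Y))^T *m Mform R *m ThetaH Y) =
    ThetaH (dagger Y *m Mquat *m Y).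
  by rewrite !ThetaHM ThetaH_dagger ThetaH_Mquat -scalemxAr -scalemxAl.
split=> [[_ /= h]|h].
  by apply: ThetaH_inj; rewrite -E h ThetaH_Mquat.
split=> /=; first by exists Y.
by apply: (scalerI imag_neq0); rewrite E h ThetaH_Mquat.
Qed.

Lemma spin_mulV Y : dagger Y *m Mquat *m Y = Mquat ->
  exists V, V *m Y = 1%:M /\ Y *m V = 1%:M.
Proof.
move=> h; exists (Mquat *m (dagger Y *m Mquat)).
have VY : Mquat *m (dagger Y *m Mquat) *m Y = 1%:M.
  by rewrite -mulmxA h Mquat_sqr.
(* That a left inverse is also a right inverse is pulled back from complex matrices, since H is not
   commutative. *)
split=> //; apply: ThetaH_inj; rewrite ThetaHM ThetaH1.
by apply: mulmx1C; rewrite -ThetaHM VY ThetaH1.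
Qed.

(* Conjugation by [Y] acts on the one-vectors through [X], without inverting [Y]. *)
Definition conjugates Y X :=
  forall n, Y *m hvecf (fun m => (m == n)%:R) = hvecf (X^~ n) *m Y.

Lemma conjugatesP Y X : dagger Y *m Mquat *m Y = Mquat ->
  conjugates Y X <-> forall n,
    ThetaH Y *m onevec R n *m invmx (ThetaH Y) = \sum_m (X m n)%:C *: onevec R m.
Proof.
move=> /spin_mulV [V [_ YV]].
have uY : ThetaH Y \in unitmx.
  by apply: (@mulmx1_unit _ _ _ (ThetaH V) _).1; rewrite -ThetaHM YV ThetaH1.
have E n : Y *m hvecf (fun m => (m == n)%:R) = hvecf (X^~ n) *m Y <->
    ThetaH Y *m onevec R n = (\sum_m (X m n)%:C *: onevec R m) *m ThetaH Y.
  split=> h.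
    apply: (scalerI imag_neq0).
    rewrite scalemxAr -ThetaH_onevec -ThetaHM h ThetaHM ThetaH_hvec.
    by rewrite -scalemxAl.
  apply: ThetaH_inj; rewrite !ThetaHM ThetaH_onevec ThetaH_hvec.
  by rewrite -scalemxAr h -scalemxAl.
split=> h n.
  by have /E -> := h n; rewrite mulmxK.
by apply/E; rewrite -h mulmxKV.
Qed.

Lemma hvecf_inj : injective (@hvecf R).
Proof.
(* The upper left entry gives the coordinates 2, 3, 4; the off-diagonal ones give the difference and
   the sum of coordinates 1 and 5. *)
move=> x y xy; have [E0 E1 E2 _] := mx2_inj xy.
have [_ x2 x1 x3] := qr_inj E0; have [_ x04 _ _] := qr_inj E1; have [_ x04' _ _] := qr_inj E2.
by apply/funext; elim/ord5_ind => //; lra.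
Qed.

Lemma conjugates_inj Y X X' : dagger Y *m Mquat *m Y = Mquat ->
  conjugates Y X -> conjugates Y X' -> X = X'.
Proof.
move=> /spin_mulV [V [_ YV]] YX YX'; apply/matrixP => m n.
suff : hvecf (X^~ n) = hvecf (X'^~ n) by move/hvecf_inj/(congr1 (@^~ m)).
by rewrite -[LHS]mulmx1 -YV mulmxA -YX YX' -mulmxA YV mulmx1.
Qed.

Lemma Phi41_conjugates Y X : dagger Y *m Mquat *m Y = Mquat ->
  conjugates Y X -> Phi41 Y = X.
Proof.
move=> sY YX; apply: xget_unique; first exact/(conjugatesP X sY).
by move=> X' /(conjugatesP X' sY) YX'; apply: conjugates_inj YX' YX.
Qed.

(* [Phi41 Y] is the junk value 0 when [Y] does not act on the one-vectors. *)
Lemma conjugates_Phi41 Y X : dagger Y *m Mquat *m Y = Mquat ->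
  X != 0 -> Phi41 Y = X -> conjugates Y X.
Proof.
move=> sY X0 YX; apply/(conjugatesP X sY); move: YX; rewrite /Phi41.
have [[X' X'P]|noX] := pselect (exists X' : 'M[R]_5, forall n,
     ThetaH Y *m onevec R n *m invmx (ThetaH Y) = \sum_m (X' m n)%:C *: onevec R m).
  move=> <-; apply: (@xgetPex _ point [set X' : 'M[R]_5 | forall n,
     ThetaH Y *m onevec R n *m invmx (ThetaH Y) = \sum_m (X' m n)%:C *: onevec R m]).
  by exists X'.
rewrite xgetPN => [XE|X' X'P]; last by apply: noX; exists X'.
by case/eqP: X0; rewrite -XE; apply/matrixP => i j; rewrite !mxE.
Qed.

(** i V_2 = j I and i V_4 = k I force real entries; then i V_3 = diag(i, -i) kills the off-diagonal
    ones, and i V_1, with i off the diagonal, equates the diagonal ones. *)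
Lemma centralizer_onevec W :
  (forall n : 'I_5, W *m hvecf (fun m => (m == n)%:R) = hvecf (fun m => (m == n)%:R) *m W) ->
  exists a, W = mx2 (qr a 0 0 0) 0 0 (qr a 0 0 0).
Proof.
move=> WC; rewrite [W]mx2E in WC *.
have [p0 [p1 [p2 [p3 pE]]]] := quatE (W 0 0).
have [q0 [q1 [q2 [q3 qE]]]] := quatE (W 0 1).
have [r0 [r1 [r2 [r3 rE]]]] := quatE (W 1 0).
have [s0 [s1 [s2 [s3 sE]]]] := quatE (W 1 1).
rewrite pE qE rE sE {pE qE rE sE W} in WC *.
have := WC o1; rewrite /hvecf/= mulr1n !mulr0n hvecM mulmx_hvec !(qrM, qrD).
move=> /(@mx2_inj (quat R))[P Q S T].
have [p1z p3z] : p1 = 0 /\ p3 = 0 by have [? ? ? ?] := qr_inj P; split; lra.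
have [q1z q3z] : q1 = 0 /\ q3 = 0 by have [? ? ? ?] := qr_inj Q; split; lra.
have [r1z r3z] : r1 = 0 /\ r3 = 0 by have [? ? ? ?] := qr_inj S; split; lra.
have [s1z s3z] : s1 = 0 /\ s3 = 0 by have [? ? ? ?] := qr_inj T; split; lra.
rewrite {P Q S T} p1z p3z q1z q3z r1z r3z s1z s3z in WC *.
have := WC o3; rewrite /hvecf/= mulr1n !mulr0n hvecM mulmx_hvec !(qrM, qrD).
move=> /(@mx2_inj (quat R))[P Q S T].
have p2z : p2 = 0 by have [_ ? _ _] := qr_inj P; lra.
have q2z : q2 = 0 by have [_ ? _ _] := qr_inj Q; lra.
have r2z : r2 = 0 by have [_ ? _ _] := qr_inj S; lra.
have s2z : s2 = 0 by have [_ ? _ _] := qr_inj T; lra.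
rewrite {P Q S T} p2z q2z r2z s2z in WC *.
have := WC o2; rewrite /hvecf/= mulr1n !mulr0n hvecM mulmx_hvec !(qrM, qrD).
move=> /(@mx2_inj (quat R))[_ Q S _].
have q0z : q0 = 0 by have [_ ? _ _] := qr_inj Q; lra.
have r0z : r0 = 0 by have [_ ? _ _] := qr_inj S; lra.
have := WC o0; rewrite /hvecf/= mulr1n !mulr0n hvecM mulmx_hvec !(qrM, qrD).
move=> /(@mx2_inj (quat R))[_ Q' _ _].
have s0p : s0 = p0 by have [_ ? _ _] := qr_inj Q'; lra.
by exists p0; rewrite q0z r0z s0p.
Qed.

(** Quaternionic conjugation reverses products; the rule is pulled back from complex matrices. *)
Lemma daggerM A B : dagger (A *m B) = dagger B *m dagger A.
Proof.
apply: ThetaH_inj; rewrite ThetaHM !ThetaH_dagger ThetaHM /conjCmx.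
by rewrite (map_mxM (@conjc R)) trmx_mul.
Qed.

Lemma dagger1 : dagger 1%:M = 1%:M :> 'M[quat R]_2.
Proof. by rewrite mx2_1 dagger_mx2 qr1 qr0 !qconj_qr oppr0. Qed.

Lemma daggerN A : dagger (- A) = - dagger A.
Proof.
apply/matrixP => i j; rewrite !mxE.
by case: (A j i) => -[? ?] [? ?]; rewrite /qconj/=; congr Quat;
  apply/eqP; rewrite eq_complex/= !eqxx.
Qed.

Lemma fiber41 Y X : dagger Y *m Mquat *m Y = Mquat -> conjugates Y X -> X != 0 ->
  Phi41_fiber X = [set Y; - Y].
Proof.
move=> sY YX X0; apply/seteqP; split=> [Y' [/Spin41P sY' Y'X]|Y' [->|->]].
- have {}Y'X := conjugates_Phi41 sY' X0 Y'X.
  have [V [VY YV]] := spin_mulV sY.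
  have [n|a aE] := @centralizer_onevec (V *m Y').
    rewrite -mulmxA Y'X !mulmxA; congr (_ *m _).
    by rewrite -[LHS]mulmx1 -YV mulmxA -(mulmxA V) -YX mulmxA VY mul1mx.
  have Y'E : Y' = Y *m mx2 (qr a 0 0 0) 0 0 (qr a 0 0 0).
    by rewrite -aE mulmxA YV mul1mx.
  (* Rewriting the inner [Mquat] through Y lets Y V = 1 cancel on both sides. *)
  have : dagger (V *m Y') *m Mquat *m (V *m Y') = Mquat.
    rewrite daggerM -[Mquat in LHS]sY -!mulmxA (mulmxA Y V) YV mul1mx.
    by rewrite 2!mulmxA -(mulmxA _ (dagger V)) -daggerM YV dagger1 mulmx1 mulmxA.
  rewrite aE dagger_mx2 {1}/Mquat mulmx_hvec mx2M !qconj_qr qr0 !(qrM, qrD).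
  (* The upper right entries are a^2 i and i. *)
  move=> /(@mx2_inj (quat R))[_ /qr_inj[_ a2 _ _] _ _].
  have /eqP : a ^+ 2 = 1 ^+ 2 by nra.
  rewrite eqf_sqr => /orP[] /eqP a1; rewrite Y'E a1; [left | right].
    by rewrite -mx2_1 mulmx1.
  rewrite (_ : mx2 _ _ _ _ = - 1%:M) ?mulmxN ?mulmx1//.
  by rewrite mx2_1 mx2N qr0 qr1 !qrN oppr0.
- by split; [exact/Spin41P | exact: Phi41_conjugates].
- have sNY : dagger (- Y) *m Mquat *m - Y = Mquat.
    by rewrite daggerN mulNmx mulmxN mulNmx opprK.
  split; first exact/Spin41P.
  by apply: Phi41_conjugates => // n; rewrite mulNmx mulmxN YX.
Qed.

End Fibers.

(** * Givens matrices in terms of the half parameter *)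

Section GivensFibers.
Variable R : realType.
Local Open Scope complex_scope.
Implicit Types (c s : R) (Y : 'M[quat R]_2).

Lemma qunitE : [/\ qi = qr 0 1 0 0 :> quat R, qj = qr 0 0 1 0 :> quat R
  & qk = qr 0 0 0 1 :> quat R].
Proof. by []. Qed.

(** The action of Y is quadratic in its half-angle entries; in this form the table reduces to
    polynomial identities. *)
Lemma Rmx_half i j (t : R) : Rmx i j t =
  planar i j (mx2 (cos (t / 2) ^+ 2 - sin (t / 2) ^+ 2) (- (cos (t / 2) * sin (t / 2) *+ 2))
                  (cos (t / 2) * sin (t / 2) *+ 2) (cos (t / 2) ^+ 2 - sin (t / 2) ^+ 2)).
Proof.
by rewrite /Rmx [in LHS](splitr t) cosD sinD -!expr2 (mulrC (sin _)) -mulr2n.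
Qed.

Lemma Hmx_half i j (t : R) : Hmx i j t =
  planar i j (mx2 (cosh (t / 2) ^+ 2 + sinh (t / 2) ^+ 2) (cosh (t / 2) * sinh (t / 2) *+ 2)
                  (cosh (t / 2) * sinh (t / 2) *+ 2) (cosh (t / 2) ^+ 2 + sinh (t / 2) ^+ 2)).
Proof.
by rewrite /Hmx [in LHS](splitr t) coshD sinhD -!expr2 (mulrC (sinh _)) -mulr2n.
Qed.

(** Rules out the default value 0 of [Phi41], as [fiber41] demands. *)
Lemma Rmx_neq0 (i j : 'I_5) (t : R) : i != j -> i != ord_max -> j != ord_max ->
  Rmx i.+1 j.+1 t != 0.
Proof.
move=> ij im jm; apply: contra_eq_neq (det_Rmx t ij im jm) => ->.
by rewrite det0 eq_sym oner_neq0.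
Qed.

Lemma Hmx_neq0 (i : 'I_5) (t : R) : i != ord_max -> Hmx i.+1 5 t != 0.
Proof.
move=> im; apply: contra_eq_neq (det_Hmx t im) => ->.
by rewrite det0 eq_sym oner_neq0.
Qed.

Lemma expR_half (t : R) : expR (t / 2) = cosh (t / 2) + sinh (t / 2).
Proof. by rewrite /cosh /sinh; field. Qed.

Lemma expRN_half (t : R) : expR (- t / 2) = cosh (t / 2) - sinh (t / 2).
Proof. by rewrite /cosh /sinh mulNr; field. Qed.

End GivensFibers.

(** * The entries of the table *)

Ltac quat_ring :=
  congr mx2; congr qr;
  (* The relation used is c^2 = 1 - s^2 for rotations and c^2 = 1 + s^2 for hyperbolic ones. *)
  match goal with h : _ ^+ 2 = _ |- _ => ring: h end.

Ltac spin_eq :=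
  rewrite dagger_mx2 /Mquat mulmx_hvec mx2M !qconj_qr !(qrM, qrD); quat_ring.

Ltac conjugates_eq :=
  elim/ord5_ind; rewrite /hvecf !mxE /= ?mulr1n ?mulr0n hvecM mulmx_hvec !(qrM, qrD);
  quat_ring.

Ltac Rmx_fiber t :=
  apply: fiber41 => //;
  [ move: (cos _) (sin _) (cos2sin2 (t / 2)) => c s h; spin_eq
  | rewrite Rmx_half; move: (cos _) (sin _) (cos2sin2 (t / 2)) => c s h; conjugates_eq ].

Ltac Hmx_fiber t :=
  apply: fiber41 => //;
  [ move: (cosh _) (sinh _) (cosh_sqr (t / 2)) => c s h; spin_eq
  | rewrite Hmx_half; move: (cosh _) (sinh _) (cosh_sqr (t / 2)) => c s h; conjugates_eq ].

Lemma fiber_R14 (R : realType) (t : R) : Phi41_fiber (Rmx 1 4 t) =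
  let Y := mx2 (cos (t / 2))%:A (- sin (t / 2) *: qj) (- sin (t / 2) *: qj) (cos (t / 2))%:A in
  [set Y; - Y].
Proof.
have X0 := @Rmx_neq0 R o0 o3 t isT isT isT; have [_ qjE _] := qunitE R.
rewrite /= qjE !qrA !qrZ; Rmx_fiber t.
Qed.

(** R13, H15 and H35 come from SL(2, R): i V_1, i V_3, i V_5 span i times the real traceless
    matrices, on which it acts by conjugation, while i V_2 = j I and i V_4 = k I are fixed. *)
Lemma fiber_R13 (R : realType) (t : R) : Phi41_fiber (Rmx 1 3 t) =
  let Y := mx2 (cos (t / 2))%:A (sin (t / 2))%:A (- (sin (t / 2))%:A) (cos (t / 2))%:A in
  [set Y; - Y].
Proof.
have X0 := @Rmx_neq0 R o0 o2 t isT isT isT.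
rewrite /= !qrA qrN; Rmx_fiber t.
Qed.

Lemma fiber_R12 (R : realType) (t : R) : Phi41_fiber (Rmx 1 2 t) =
  let Y := mx2 (cos (t / 2))%:A (sin (t / 2) *: qk) (sin (t / 2) *: qk) (cos (t / 2))%:A in
  [set Y; - Y].
Proof.
have X0 := @Rmx_neq0 R o0 o1 t isT isT isT; have [_ _ qkE] := qunitE R.
rewrite /= qkE !qrA !qrZ; Rmx_fiber t.
Qed.

(** Preserving [Mquat] forces real diagonal entries to be mutually inverse. *)
Lemma fiber_H15 (R : realType) (t : R) : Phi41_fiber (Hmx 1 5 t) =
  let Y := mx2 (expR (- t / 2))%:A 0 0 (expR (t / 2))%:A in
  [set Y; - Y].
Proof.
have X0 := @Hmx_neq0 R o0 t isT.
rewrite /= expR_half expRN_half qr0 !qrA; Hmx_fiber t.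
Qed.

(** Conjugation by the unit quaternion e^(-i t/2) fixes i and turns the (j, k) plane, which carries
    V_2 and V_4. As R_42 at t is R_24 at -t, this covers the factor R24. *)
Lemma fiber_R42 (R : realType) (t : R) : Phi41_fiber (Rmx 4 2 t) =
  let Y := mx2 ((cos (t / 2))%:A - sin (t / 2) *: qi) 0 0 ((cos (t / 2))%:A - sin (t / 2) *: qi) in
  [set Y; - Y].
Proof.
have X0 := @Rmx_neq0 R o3 o1 t isT isT isT; have [qiE _ _] := qunitE R.
rewrite /= qr0 qiE qrA qrZ qrN qrD; Rmx_fiber t.
Qed.

(** As k anticommutes with i, the diagonal entries must be conjugate, not equal, for [Mquat] to be
    preserved. *)
Lemma fiber_R32 (R : realType) (t : R) : Phi41_fiber (Rmx 3 2 t) =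
  let Y := mx2 ((cos (t / 2))%:A + sin (t / 2) *: qk) 0 0 ((cos (t / 2))%:A - sin (t / 2) *: qk) in
  [set Y; - Y].
Proof.
have X0 := @Rmx_neq0 R o2 o1 t isT isT isT; have [_ _ qkE] := qunitE R.
rewrite /= qr0 qkE qrA qrZ qrN !qrD; Rmx_fiber t.
Qed.

Lemma fiber_H25 (R : realType) (t : R) : Phi41_fiber (Hmx 2 5 t) =
  let Y := mx2 (cosh (t / 2))%:A (sinh (t / 2) *: qk) (- sinh (t / 2) *: qk) (cosh (t / 2))%:A in
  [set Y; - Y].
Proof.
have X0 := @Hmx_neq0 R o1 t isT; have [_ _ qkE] := qunitE R.
rewrite /= qkE !qrA !qrZ; Hmx_fiber t.
Qed.

Lemma fiber_H35 (R : realType) (t : R) : Phi41_fiber (Hmx 3 5 t) =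
  let Y := mx2 (cosh (t / 2))%:A (sinh (t / 2))%:A (sinh (t / 2))%:A (cosh (t / 2))%:A in
  [set Y; - Y].
Proof.
have X0 := @Hmx_neq0 R o2 t isT.
rewrite /= !qrA; Hmx_fiber t.
Qed.

Lemma fiber_H45 (R : realType) (t : R) : Phi41_fiber (Hmx 4 5 t) =
  let Y := mx2 (cosh (t / 2))%:A (- sinh (t / 2) *: qj) (sinh (t / 2) *: qj) (cosh (t / 2))%:A in
  [set Y; - Y].
Proof.
have X0 := @Hmx_neq0 R o3 t isT; have [_ qjE _] := qunitE R.
rewrite /= qjE !qrA !qrZ; Hmx_fiber t.
Qed.

Theorem proposition31 (R : realType) :
  (forall X : 'M[R]_5, SO41p X ->
     exists s t : 10.-tuple R,
       [/\ X = \prod_(A <- givens_factors s) A,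
           X = \prod_(A <- givens_factors t) A
         & givens_factors s <> givens_factors t])
  /\
  (forall theta : R,
     let c : quat R := (cos (theta / 2))%:A in
     let s : R := sin (theta / 2) in
     let ch : quat R := (cosh (theta / 2))%:A in
     let sh : R := sinh (theta / 2) in
     let em : quat R := (expR (- theta / 2))%:A in
     let ep : quat R := (expR (theta / 2))%:A in
     let fiber_is X Y := Phi41_fiber X = [set Y; - Y] in
     fiber_is (Rmx 1 4 theta) (mx2 c (- s *: qj) (- s *: qj) c)
     /\ fiber_is (Rmx 1 3 theta) (mx2 c s%:A (- s%:A) c)
     /\ fiber_is (Rmx 1 2 theta) (mx2 c (s *: qk) (s *: qk) c)
     /\ fiber_is (Hmx 1 5 theta) (mx2 em 0 0 ep)
     /\ fiber_is (Rmx 4 2 theta) (mx2 (c - s *: qi) 0 0 (c - s *: qi))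
     /\ fiber_is (Rmx 3 2 theta) (mx2 (c + s *: qk) 0 0 (c - s *: qk))
     /\ fiber_is (Hmx 2 5 theta) (mx2 ch (sh *: qk) (- sh *: qk) ch)
     /\ fiber_is (Hmx 3 5 theta) (mx2 ch sh%:A sh%:A ch)
     /\ fiber_is (Hmx 4 5 theta) (mx2 ch (- sh *: qj) (sh *: qj) ch)).
Proof.
split=> [X /SO41p_proper|t]; first exact: givens_decomposition_nonunique.
move=> c s ch sh em ep fiber_is.
split; first exact: fiber_R14.
split; first exact: fiber_R13.
split; first exact: fiber_R12.
split; first exact: fiber_H15.
split; first exact: fiber_R42.
split; first exact: fiber_R32.
split; first exact: fiber_H25.
split; first exact: fiber_H35.
exact: fiber_H45.
Qed.
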